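(* Let $j>0$ be a real number and let $n\ge 1$ be an integer. Let $X$ be a random variable with distribution function $F_X(x)=1-\exp\left(-\frac{x}{2}\right)$, $x>0$, and let $X_{(1)}\le X_{(2)}\le\cdots\le X_{(n)}$ denote the order statistics based on a random sample $X_1,\dots,X_n$ (i.i.d.) from $X$. Let $\gamma_j^*(F_n)$ be the statistic computed from this sample, and let $e_{k,n}^{(j)}=\frac{1}{j}\left(\frac{n-k+1}{n}\right)^{j}-\frac{1}{j(j+1)}$ for $k=1,\dots,n$, where for the fixed $n$ it is assumed that $e_{i,n}^{(j)}\neq e_{k,n}^{(j)}$ for all $i\neq k$. Then for every real $x$, $$P\left(\gamma_j^*(F_n)\le x\right)=1-\sum_{i=1}^{n}\ \prod_{\substack{k=1\\ k\neq i}}^{n}\left(\frac{e_{i,n}^{(j)}-x}{e_{i,n}^{(j)}-e_{k,n}^{(j)}}\right) I\left(x,e_{i,n}^{(j)}\right),$$ where $I(x,y)=1$ if $x<y$ and $I(x,y)=0$ if $x\ge y$.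
   Context: For a sample $X_1,\dots,X_n$ with order statistics $X_{(1)}\le\cdots\le X_{(n)}$ and sample mean $\bar X_n=\frac1n\sum_{i=1}^n X_i$, and a positive real number $j$, define $$\gamma_j(F_n)=\sum_{k=1}^n X_{(k)}\left[\frac1j\left\{\left(\frac{n-k+1}{n}\right)^{j+1}-\left(\frac{n-k}{n}\right)^{j+1}\right\}-\frac{1}{j(j+1)n}\right],\qquad \gamma_j^*(F_n)=\frac{\gamma_j(F_n)}{\bar X_n}.$$ Equivalently, with the normalized spacings $D_k=(n-k+1)(X_{(k)}-X_{(k-1)})$ and $X_{(0)}=0$, one has $\gamma_j^*(F_n)=\left(\sum_{k=1}^n e_{k,n}^{(j)}D_k\right)/\left(\sum_{k=1}^n D_k\right)$. The empty product is $1$. *)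

(* Defs.v *)
From HB Require Import structures.
From mathcomp Require Import all_boot all_order all_algebra.
From mathcomp Require Import all_classical all_reals all_analysis.

Set Implicit Arguments.
Unset Strict Implicit.
Unset Printing Implicit Defensive.

Import Order.TTheory GRing.Theory Num.Theory.
Import numFieldNormedType.Exports.

Local Open Scope classical_set_scope.
Local Open Scope ring_scope.

(* The product rule is required for every subfamily J and every choice of Borel
   sets; J = set0 holds trivially since the empty intersection is setT. *)
Definition mutually_independent (d : measure_display) (T : measurableType d)
    (R : realType) (P : probability T R) (I : finType)
    (X : I -> {RV P >-> R}) : Prop :=
  forall (J : {set I}) (B : I -> set R),
    (forall i, measurable (B i)) ->
    P [set w | forall i, i \in J -> B i (X i w)] =
    (\prod_(i in J) P (X i @^-1` B i))%E.

(* k counts from 1: order_stat x 1 is the minimum, order_stat x n the maximum;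
   the value is only meaningful for 1 <= k <= n. *)
Definition order_stat (R : realType) (n : nat) (x : 'I_n -> R) (k : nat) : R :=
  (sort <=%R (codom x))`_k.-1.

Definition sample_mean (R : realType) (n : nat) (x : 'I_n -> R) : R :=
  (\sum_(i < n) x i) / n%:R.

(* The subtractions n - k + 1 and n - k are on nat; they are exact as k <= n. *)
Definition gamma_stat (R : realType) (j : R) (n : nat) (x : 'I_n -> R) : R :=
  \sum_(1 <= k < n.+1)
    order_stat x k *
    (j^-1 * (((n - k + 1)%:R / n%:R) `^ (j + 1)
             - ((n - k)%:R / n%:R) `^ (j + 1))
     - (j * (j + 1) * n%:R)^-1).

Definition gamma_star (R : realType) (j : R) (n : nat) (x : 'I_n -> R) : R :=
  gamma_stat j x / sample_mean x.

Definition e_coef (R : realType) (j : R) (n k : nat) : R :=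
  j^-1 * ((n - k + 1)%:R / n%:R) `^ j - (j * (j + 1))^-1.

Definition ind_lt (R : realType) (x y : R) : R := if x < y then 1 else 0.

(* Main.v *)
Require Import Defs.
From HB Require Import structures.
From mathcomp Require Import all_boot all_order all_algebra.
From mathcomp Require Import all_classical all_reals all_analysis.
From mathcomp Require Import measurable_realfun ring lra.

Set Implicit Arguments.
Unset Strict Implicit.
Unset Printing Implicit Defensive.

Import Order.TTheory GRing.Theory Num.Theory.
Import numFieldNormedType.Exports.

Local Open Scope classical_set_scope.
Local Open Scope ring_scope.

(** Almost surely all observations, hence their mean, are positive, so the
    event that [gamma_star] is at most [x] is the event that the linear
    combination of normalized spacings with coefficients [e_coef j n k - x] is
    nonpositive ([spacing_sum_gamma], by summation by parts, and
    [gamma_star_le]).  These coefficients strictly decrease in [k].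

    The normalized spacings of an exponential sample are again independent
    exponential variables.  Instead of their joint law, the proof uses the
    recursion behind it ([spacing_sum_recursion]): split the space according to
    which observation is the smallest, integrate over its value [t], and note
    that by lack of memory the other observations, shifted by [t] and
    restricted to exceed it, form an exponential sample with one variable less.
    The induction hypothesis applies to this shifted sample because
    [exponential_family] allows an arbitrary total mass [K].  The product law
    needed to integrate over the minimum is [family_disintegration].

    For decreasing coefficients [c] and [y > 0] the recursion gives the lower
    tail [K * hypoexp_tail c y], a combination of exponentials with the
    partial-fraction weights [hypoexp_weight] ([spacing_sum_tail]).  Each step
    adds a new largest coefficient [a].  When [a >= 0] every exponential
    integrates over the whole half-line and its weight just gains the factor
    [b / (b - a)].  When [a < 0] all coefficients are negative, the event is
    certain once the minimum is large, and the weight of the new exponential is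
    what remains from the identity that the weights sum to 1
    ([hypoexp_weight_sum], Lagrange interpolation).

    A last step at [y = 0] gives the sum of the weights of the negative
    coefficients, which by the same identity is 1 minus the sum over the
    positive ones; if no coefficient is positive, the probability is 1. *)

(** * Partial-fraction weights *)

(** The law of the combination, with coefficients [c], of independent standard
    exponential variables is the signed mixture, with these weights, of the
    laws of the single multiples: [hypoexp_weight c a] is the coefficient of
    [1 / (1 - a s)] in the partial-fraction expansion of the product of the
    transforms [1 / (1 - b s)]. *)
Definition hypoexp_weight (F : fieldType) (c : seq F) (a : F) : F :=
  \prod_(b <- c | b != a) (a / (a - b)).

Lemma hypoexp_weight_cons (F : fieldType) (c : seq F) (a b : F) : b != a ->
  hypoexp_weight (b :: c) a = a / (a - b) * hypoexp_weight c a.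
Proof. by move=> ba; rewrite /hypoexp_weight big_cons ba. Qed.

(** The monomial of degree [size c - 1] equals its Lagrange interpolant at the
    points of [c]; the identity compares leading coefficients.  Interpolating
    this monomial, rather than a constant at the inverses, lets 0 occur in
    [c]. *)
Lemma hypoexp_weight_sum (F : fieldType) (c : seq F) : uniq c -> c != [::] ->
  \sum_(a <- c) hypoexp_weight c a = 1.
Proof.
move=> uc c0; set n := size c.
have n_gt0 : (0 < n)%N by rewrite lt0n size_eq0.
pose N a : {poly F} := \prod_(b <- c | b != a) ('X - b%:P).
have szN a : a \in c -> size (N a) = n.
  move=> ac; rewrite /N -big_filter size_prod_XsubC size_filter.
  by rewrite -(count_predC (pred1 a) c) count_uniq_mem// ac add1n in n n_gt0 *.
have N1 a : a \in c -> (N a)`_n.-1 = 1.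
  move=> ac; rewrite -(szN _ ac) -/(lead_coef _).
  exact/monicP/monic_prod_XsubC.
pose u a := a ^+ n.-1 * \prod_(b <- c | b != a) (a - b)^-1.
pose p := \sum_(a <- c) u a *: N a - 'X^(n.-1).
have Nx a x : (N a).[x] = \prod_(b <- c | b != a) (x - b).
  by rewrite horner_prod; apply: eq_bigr => b _; rewrite hornerXsubC.
have uw a : a \in c -> u a = hypoexp_weight c a.
  move=> ac; rewrite /u /hypoexp_weight big_split/=; congr (_ * _).
  rewrite big_const_seq -size_filter.
  have -> : n.-1 = size [seq b <- c | b != a].
    by rewrite -(szN _ ac) /N -big_filter size_prod_XsubC.
  by elim: (size _) => [|k IH] //=; rewrite exprS IH.
have p0 : p = 0.
  apply: (@roots_geq_poly_eq0 _ p c) => //; last first.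
    rewrite -/n /p (leq_trans (size_polyD _ _))// geq_max size_polyN size_polyXn.
    rewrite prednK// leqnn andbT big_seq.
    elim/big_ind: _ => [|q s qn sn|a ac].
    - by rewrite size_poly0.
    - by rewrite (leq_trans (size_polyD _ _))// geq_max qn sn.
    - by rewrite (leq_trans (size_scale_leq _ _))// szN.
  apply/allP => x xc; rewrite rootE /p hornerD hornerN hornerXn horner_sum subr_eq0.
  rewrite (bigD1_seq x)//= hornerZ Nx [X in _ + X]big1 ?addr0; last first.
    move=> a ax; rewrite hornerZ Nx (big_rem x)//= eq_sym ax.
    by rewrite subrr mul0r mulr0.
  rewrite /u -mulrA -big_split/= big1 ?mulr1// => b bx.
  by rewrite mulVf// subr_eq0 eq_sym.
have := congr1 (fun q : {poly F} => q`_n.-1) p0.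
rewrite /p coefB coefXn eqxx coef0 coef_sum => /subr0_eq/= E.
apply: etrans E.
by apply: eq_big_seq => a ac; rewrite coefZ N1// mulr1 uw.
Qed.

(** * Combinations of spacings of a sorted sample *)

(** The factor [size s] counts the current value and those above it, so it is
    the factor [n - k + 1] of the normalized spacing [D_k]; [p] is the value
    preceding [s]. *)
Fixpoint spacing_sum (R : realType) (c : seq R) (p : R) (s : seq R) : R :=
  match c, s with
  | a :: c', z :: s' => a * (size s)%:R * (z - p) + spacing_sum c' z s'
  | _, _ => 0
  end.

Lemma spacing_sum_shift (R : realType) (c : seq R) (p t : R) (s : seq R) :
  spacing_sum c p s = spacing_sum c (p - t) [seq z - t | z <- s].
Proof.
elim: c p s => [|a c IH] p [|z s] //=; rewrite size_map -IH.
by congr (_ + _); ring.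
Qed.

Lemma spacing_sum_le0 (R : realType) (c : seq R) (p : R) (s : seq R) :
  all (<= 0) c -> path <=%R p s -> spacing_sum c p s <= 0.
Proof.
elim: c p s => [|a c IH] p [|z s] //= /andP[a0 c0] /andP[pz zs].
by rewrite -[leRHS]addr0 lerD ?IH// mulr_le0_ge0 ?subr_ge0// mulr_le0_ge0.
Qed.

Definition sorted_values (R : realType) (n : nat) (x : 'I_n -> R) : seq R :=
  sort <=%R (codom x).

Lemma size_sorted_values (R : realType) (n : nat) (x : 'I_n -> R) :
  size (sorted_values x) = n.
Proof. by rewrite size_sort size_codom card_ord. Qed.

Lemma sorted_values_sub (R : realType) (n : nat) (x : 'I_n -> R) (t : R) :
  sorted_values (fun l => x l - t) = [seq z - t | z <- sorted_values x].
Proof.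
have mono : {mono (fun z => z - t) : u v / u <= v}.
  by move=> u v; rewrite lerD2r.
rewrite /sorted_values (map_sort mono) !codomE.
by congr (sort _ _); exact: map_comp.
Qed.

Lemma sorted_values_min (R : realType) (n : nat) (x : 'I_n.+1 -> R)
    (i : 'I_n.+1) : (forall l, x i <= x l) ->
  sorted_values x = x i :: sorted_values (fun l => x (lift i l)).
Proof.
move=> xi; apply: (sorted_eq le_trans le_anti).
- exact/sort_sorted/le_total.
- rewrite /= path_min_sorted; first exact/sort_sorted/le_total.
  by apply/allP => z; rewrite mem_sort => /codomP[l ->].
rewrite perm_sort perm_sym.
apply: (@perm_trans _ (x i :: codom (fun l => x (lift i l)))).
  by rewrite perm_cons perm_sort.
rewrite !codomE (map_comp x (lift i)) -map_cons; apply: perm_map.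
apply: uniq_perm; rewrite ?enum_uniq//.
  rewrite /= map_inj_uniq ?enum_uniq ?andbT; last exact: lift_inj.
  by apply/negP => /mapP[l _ /eqP]; rewrite (negbTE (neq_lift _ _)).
move=> l; rewrite mem_enum inE; case: (unliftP i l) => [k ->|->].
  by rewrite map_f ?orbT// mem_enum.
by rewrite eqxx.
Qed.

(** * The exponential law *)

Lemma finite_measure_tail_unique (R : realType)
    (m1 m2 : {measure set (measurableTypeR R) -> \bar R}) :
  (m1 setT < +oo)%E ->
  (forall x, m1 `]x, +oo[%classic = m2 `]x, +oo[%classic) ->
  forall A, measurable A -> m1 A = m2 A.
Proof.
move=> m1oo m12 A mA.
have GmR : @measurable _ (measurableTypeR R) = <<s @RGenOInfty.G R >>.
  by rewrite [LHS]RGenOInfty.measurableE.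
apply: (@g_sigma_algebra_measure_unique _ R (measurableTypeR R)
  (@RGenOInfty.G R) _ (fun k => `](- k%:R), +oo[%classic) _ _ m1 m2).
- by rewrite GmR; exact: sub_sigma_algebra.
- by move=> i; exists (- i%:R).
- apply/seteqP; split => // x _.
  exists (Num.truncn `|x|).+1 => //=; rewrite in_itv/= andbT ltrNl.
  by rewrite (le_lt_trans _ (truncnS_gt _))// -normrN ler_norm.
- move=> _ _ [x ->] [y ->]; exists (Num.max x y); apply/seteqP; split => z /=;
    rewrite !in_itv/= !andbT gt_max.
    by case=> -> ->.
  by move=> /andP[].
- by move=> _ [x ->].
- by move=> k; rewrite (le_lt_trans _ m1oo)// le_measure// inE.
- by rewrite -GmR.
Qed.

(** The probability structure of [exponential_prob r] depends on a proof of
    [0 < r] that unification cannot find, hence this packed version. *)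
Definition exponential_law (R : realType) (r : R) (r_gt0 : 0 < r) :
  probability (measurableTypeR R) R.
Proof. by unshelve refine (exponential_prob r : probability _ R). Defined.

Section exponential_law_theory.
Context (R : realType) (r : R) (r_gt0 : 0 < r).
Local Notation E := (exponential_law r_gt0).

Lemma exponential_lawE A : E A = exponential_prob r A.
Proof. by []. Qed.

Lemma exponential_law_set1 (x : R) : E [set x] = 0%E.
Proof. by rewrite exponential_lawE /exponential_prob integral_set1. Qed.

Lemma exponential_law_Nyo (x : R) : x <= 0 -> E `]-oo, x[%classic = 0%E.
Proof.
move=> x0; rewrite exponential_lawE /exponential_prob integral0_eq// => z /=.
rewrite in_itv/= => zx; rewrite lt0_exponential_pdf//.
exact: lt_le_trans zx x0.
Qed.

Lemma exponential_law_Nyc (x : R) : 0 <= x ->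
  E `]-oo, x]%classic = (1 - expR (- (r * x)))%:E.
Proof.
move=> x0.
have Ex : E `[0, x]%classic = (1 - expR (- (r * x)))%:E.
  move: x0; rewrite le_eqVlt => /orP[/eqP <-|x0].
    by rewrite set_itv1 exponential_law_set1 mulr0 oppr0 expR0 subrr.
  by rewrite exponential_lawE exponential_prob_itv0c// mulNr EFinB.
rewrite (_ : `]-oo, x]%classic = `]-oo, 0[%classic `|` `[0, x]%classic); last first.
  by rewrite -itv_bndbnd_setU ?bnd_simp.
apply: etrans (measureU _ _ _ _) _ => //.
  apply/seteqP; split => // z /=; rewrite !in_itv/= => -[z0 /andP[]].
  by rewrite leNgt z0.
by rewrite -[RHS]add0e; exact: (congr2 adde (exponential_law_Nyo (lexx 0)) Ex).
Qed.

Lemma exponential_law_Nyc0 (x : R) : x <= 0 -> E `]-oo, x]%classic = 0%E.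
Proof.
move=> x0; apply: (@subset_measure0 _ _ _ E _ `]-oo, 0]%classic) => //.
  by move=> t /=; rewrite !in_itv/= => tx; exact: le_trans tx x0.
apply: etrans (exponential_law_Nyc (lexx 0)) _.
by rewrite mulr0 oppr0 expR0 subrr.
Qed.

Lemma exponential_law_oy (x : R) : 0 <= x ->
  E `]x, +oo[%classic = (expR (- (r * x)))%:E.
Proof.
move=> x0.
rewrite -setCitvl; apply: etrans (probability_setC _ _) _ => //.
apply: etrans (congr1 (fun u => 1 - u)%E (exponential_law_Nyc x0)) _.
by rewrite -EFinB opprB addrC subrK.
Qed.

Lemma exponential_law_cy (x : R) : 0 <= x ->
  E `[x, +oo[%classic = (expR (- (r * x)))%:E.
Proof.
move=> x0; rewrite -(@setU1itv _ _ _ _ false) ?bnd_simp//.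
apply: etrans (measureU _ _ _ _) _ => //.
  by apply/seteqP; split => // z [/= ->]; rewrite in_itv/= ltxx.
rewrite -[RHS]add0e.
exact: (congr2 adde (exponential_law_set1 x) (exponential_law_oy x0)).
Qed.

Lemma exponential_law_c0y : E `[0, +oo[%classic = 1%E.
Proof. by rewrite exponential_law_cy// mulr0 oppr0 expR0. Qed.

(** Lack of memory, as an identity of measures.  Both the open and the closed
    half-line occur because ties at the minimum are broken by the index. *)
Lemma exponential_law_memoryless (b : bool) (t : R) (B : set R) :
  0 <= t -> measurable B ->
  E ([set` Interval (BSide b t) +oo%O] `&` [set z | B (z - t)]) =
  ((expR (- (r * t)))%:E * E B)%E.
Proof.
move=> t0 mB.
pose U : set (measurableTypeR R) := [set` Interval (BSide b t) +oo%O].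
have mU : measurable U by exact: measurable_itv.
have mf : measurable_fun [set: measurableTypeR R]
    (fun z : measurableTypeR R => (z - t) : measurableTypeR R).
  exact: measurable_funB.
have k0 : 0 <= expR (- (r * t)) by exact: expR_ge0.
have EU : E U = (expR (- (r * t)))%:E.
  rewrite /U; case: b {U mU} => //.
    exact: exponential_law_cy.
  exact: exponential_law_oy.
have Ult z : t < z -> U z.
  by move=> tz; rewrite /U/= in_itv/= andbT; case: (b) => //=; exact: ltW.
have Ule z : U z -> t <= z.
  by rewrite /U/= in_itv/= andbT; case: (b) => //=; exact: ltW.
pose m1 := pushforward (mrestr E mU)
  (fun z : measurableTypeR R => (z - t) : measurableTypeR R).
pose m2 := mscale (NngNum k0) E.
have m1E A : m1 A = E (U `&` [set z | A (z - t)]).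
  by rewrite /m1 /pushforward /mrestr setIC.
rewrite -m1E -[RHS]/(m2 B); apply: finite_measure_tail_unique => // [|x].
  by rewrite [X in (X < _)%E](m1E setT) setIT EU ltry.
rewrite [LHS]m1E [RHS](_ : _ = (expR (- (r * t)))%:E * E `]x, +oo[%classic)%E//.
have [x0|x0] := leP 0 x.
  rewrite exponential_law_oy// -EFinM -expRD (_ : _ `&` _ = `](x + t), +oo[%classic).
    by rewrite exponential_law_oy ?addr_ge0//; congr (expR _)%:E; ring.
  apply/seteqP; split => z /=; rewrite !in_itv/= !andbT ltrBrDr.
    by case.
  by move=> xtz; split => //; apply: Ult; rewrite (le_lt_trans _ xtz)// lerDr.
rewrite (_ : _ `&` _ = U).
  rewrite EU (_ : E `]x, +oo[%classic = 1%E) ?mule1//.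
  apply/eqP; rewrite eq_le probability_le1//= -(exponential_law_c0y).
  apply: le_measure; rewrite ?inE// => z /=; rewrite !in_itv/= !andbT.
  exact: lt_le_trans.
apply/seteqP; split => z /=; first by case.
move=> /[dup] Uz /Ule tz; split => //.
by rewrite in_itv/= andbT ltrBrDr (lt_le_trans _ tz)// gtrDr.
Qed.

End exponential_law_theory.

Lemma integral_exponential_law (R : realType) (r : R) (r_gt0 : 0 < r)
    (f : measurableTypeR R -> \bar R) :
  (exponential_law r_gt0).-integrable setT f ->
  (\int[exponential_law r_gt0]_x f x =
   \int[lebesgue_measure]_x (f x * (exponential_pdf r x)%:E))%E.
Proof.
move=> intf.
have dom : exponential_law r_gt0 `<<
    (lebesgue_measure : {measure set (measurableTypeR R) -> \bar R}).
  apply/null_content_dominatesP => A mA muA0.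
  rewrite exponential_lawE; apply: null_set_integral => //.
  apply: measurable_funTS; apply/measurable_EFinP.
  exact: measurable_exponential_pdf.
rewrite -(Radon_Nikodym_change_of_variables dom)//=.
have mpdf : measurable_fun [set: measurableTypeR R]
    (fun x => (exponential_pdf r x)%:E).
  by apply/measurable_EFinP; exact: measurable_exponential_pdf.
apply: ae_eq_integral => //.
- by apply: emeasurable_funM => //; exact: measurable_int intf.
- by apply: emeasurable_funM => //; exact: measurable_int intf.
- apply: ae_eqe_mul2l => /=.
  rewrite Radon_NikodymE//=.
  case: cid => /= h [h1 h2 h3].
  apply: integral_ae_eq => //=.
  by move=> A AT mA; rewrite -h3.
Qed.

(** * Exponential samples of arbitrary mass *)

(** Under [Q / K] the variables [Y] are independent and exponential of rate
    [r].  Keeping the mass [K] avoids normalizing the restriction of [Q] to the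
    event that all other variables exceed a given one. *)
Definition exponential_family (d : measure_display) (T : measurableType d)
    (R : realType) (r : R) (m : nat) (Q : set T -> \bar R)
    (Y : 'I_m -> T -> R) (K : R) : Prop :=
  (forall l, measurable_fun [set: T] (Y l)) /\
  forall B : 'I_m -> set R, (forall l, measurable (B l)) ->
    Q [set w | forall l, B l (Y l w)] =
    (K%:E * \prod_(l < m) exponential_prob r (B l))%E.

Section disintegration.
Context (d : measure_display) (T : measurableType d) (R : realType).
Context (r : R) (r_gt0 : 0 < r) (m : nat).
Context (Q : {finite_measure set T -> \bar R}).
Context (Y : 'I_m.+1 -> T -> R) (K : R).
Hypothesis famY : exponential_family r Q Y K.
Variable i : 'I_m.+1.
Local Notation E := (exponential_law r_gt0).

(** The pi-system generating the sigma-algebra of the variables other than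
    [Y i]. *)
Definition rest_events : set (set T) :=
  [set A | exists2 B : 'I_m -> set R, (forall l, measurable (B l)) &
     A = [set w | forall l, B l (Y (lift i l) w)]].

Local Notation TG := (g_sigma_algebraType rest_events).

Lemma measurable_events n (Z : 'I_n -> T -> R) (B : 'I_n -> set R) :
  (forall l, measurable_fun [set: T] (Z l)) ->
  (forall l, measurable (B l)) -> measurable [set w | forall l, B l (Z l w)].
Proof.
move=> mZ mB.
rewrite (_ : [set _ | _] = \bigcap_(l in [set: 'I_n]) (Z l @^-1` B l)).
  apply: fin_bigcap_measurable => // l _.
  by rewrite -[X in measurable X]setTI; exact: mZ.
by apply/seteqP; split => w /= h l; [move=> _|]; exact: h.
Qed.

Let rest_measurable : rest_events `<=` measurable.
Proof. by move=> _ [B mB ->]; apply: measurable_events => // l; exact: famY.1. Qed.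

Let measurable_id_rest : measurable_fun [set: T] (fun w => w : TG).
Proof.
apply: (@measurability _ _ T TG _ _ rest_events) => // _ [A GA <-].
by rewrite setTI; exact: rest_measurable.
Qed.

Lemma measurable_rest (l : 'I_m) :
  measurable_fun [set: TG] (Y (lift i l) : TG -> R).
Proof.
move=> _ A mA; rewrite setTI; apply: sub_sigma_algebra.
exists (fun k => if k == l then A else setT).
  by move=> k; case: ifP.
apply/seteqP; split => w /=; last by move=> /(_ l); rewrite eqxx.
by move=> Aw k; case: eqP => // ->.
Qed.

Lemma family_rest_setI (A : set R) (B : 'I_m -> set R) :
  measurable A -> (forall l, measurable (B l)) ->
  Q (Y i @^-1` A `&` [set w | forall l, B l (Y (lift i l) w)]) =
  (E A * (K%:E * \prod_(l < m) exponential_prob r (B l)))%E.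
Proof.
move=> mA mB.
pose B' k := if unlift i k is Some l then B l else A.
rewrite (_ : _ `&` _ = [set w | forall k, B' k (Y k w)]).
  rewrite famY.2; last by move=> k; rewrite /B'; case: unlift.
  rewrite (bigD1_ord i)//= muleCA {1}/B' unlift_none; congr (_ * (_ * _))%E.
  by apply: eq_bigr => l _; rewrite /B' liftK.
apply/seteqP; split => w /=.
  by case=> Aw Bw k; rewrite /B'; case: unliftP => [l ->|->].
move=> h; split; first by have := h i; rewrite /B' unlift_none.
by move=> l; have := h (lift i l); rewrite /B' liftK.
Qed.

(** [Y i] is independent of the sigma-algebra of the other variables: for fixed
    [A] both sides are finite measures in [C], and they agree on the
    pi-system [rest_events]. *)
Lemma family_rest_indep (A : set R) (C : set TG) :
  measurable A -> measurable C -> Q (Y i @^-1` A `&` C) = (E A * Q C)%E.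
Proof.
move=> mA mC.
have mYA : measurable (Y i @^-1` A).
  by rewrite -[X in measurable X]setTI; exact: famY.1.
have EA : E A \is a fin_num by exact: fin_num_measure.
have EA0 : 0 <= fine (E A) by exact/fine_ge0.
pose m1 := mrestr Q mYA.
pose m2 := mscale (NngNum EA0) Q.
have m2E D : m2 D = (E A * Q D)%E by rewrite /m2 /mscale/= fineK.
have m1E D : m1 D = Q (Y i @^-1` A `&` D) by rewrite /m1 /mrestr setIC.
rewrite -m1E -m2E.
apply: (@g_sigma_algebra_measure_unique _ R T rest_events rest_measurable
  (fun=> setT) _ _ m1 m2) => //.
- by move=> _; exists (fun=> setT) => //; apply/seteqP; split.
- exact: bigcup_const.
- move=> _ _ [B1 mB1 ->] [B2 mB2 ->]; exists (fun l => B1 l `&` B2 l).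
    by move=> l; exact: measurableI.
  apply/seteqP; split => w /=; first by case=> h1 h2 l; split.
  by move=> h; split => l; have [] := h l.
- move=> _ [B mB ->]; rewrite [LHS]m1E [RHS]m2E family_rest_setI//; congr (_ * _)%E.
  have := family_rest_setI measurableT mB.
  by rewrite preimage_setT setTI probability_setT mul1e.
- move=> _; rewrite [X in (X < _)%E]m1E.
  by rewrite setIT -ge0_fin_numE//; exact: fin_num_measure.
Qed.

(* [Q] as a finite measure on the coarser sigma-algebra of [TG]. *)
Let QG : set TG -> \bar R := Q.

Let QG_measure : {measure set TG -> \bar R}.
Proof. by unshelve refine (pushforward Q (fun w => w : TG)). Defined.

HB.instance Definition _ := Measure.copy QG QG_measure.

Let QG_fin : fin_num_fun QG.
Proof.
move=> A mA; apply: fin_num_measure.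
by rewrite -[X in measurable X]setTI; exact: measurable_id_rest.
Qed.

HB.instance Definition _ := @Measure_isFinite.Build _ _ _ QG QG_fin.

Let mY : measurable_fun [set: T] (fun w => (Y i w, w) : measurableTypeR R * TG).
Proof. by apply: measurable_fun_pair => //; exact: famY.1. Qed.

Let joint_measure : {measure set (measurableTypeR R * TG) -> \bar R}.
Proof.
by unshelve refine
  (pushforward Q (fun w => (Y i w, w) : measurableTypeR R * TG)).
Defined.

(** Since [Y i] is independent of the sigma-algebra of [TG], the image of [Q]
    under [w |-> (Y i w, w)] is a product measure.  Taking the original space
    with the smaller sigma-algebra as second factor avoids a product of [m]
    copies of the real line. *)
Lemma family_disintegration (S : set (measurableTypeR R * TG)) : measurable S ->
  measurable_fun [set: measurableTypeR R] (fun t => Q (xsection S t)) /\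
  Q [set w | S (Y i w, w)] = (\int[E]_t Q (xsection S t))%E.
Proof.
move=> mS.
have mphi := @measurable_fun_xsection _ _ (measurableTypeR R) TG R QG S mS.
split; first exact: mphi.
apply/esym; refine (@product_measure_unique _ _ (measurableTypeR R) TG R E QG
  joint_measure _ S mS) => A C mA mC.
exact: family_rest_indep.
Qed.
End disintegration.

(** * Measurability of order statistics *)

Section measurability.
Context (d : measure_display) (T : measurableType d) (R : realType).

Lemma nth_sorted_values_le (n k : nat) (x : 'I_n -> R) (y : R) : (k < n)%N ->
  ((sorted_values x)`_k <= y) = (k < #|[set l | (x l <= y)%R]%SET|)%N.
Proof.
move=> kn.
have sx : sorted <=%O (sorted_values x) by exact/sort_sorted/le_total.
have -> : #|[set l | (x l <= y)%R]%SET| = count (<= y) (sorted_values x).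
  rewrite /sorted_values count_sort codomE count_map cardsE cardE enumT.
  by rewrite /enum_mem size_filter; exact: eq_count.
have [ky|yk] := ltnP; first by rewrite nth_count_le.
by apply/negbTE; rewrite -ltNge nth_count_gt// yk size_sorted_values.
Qed.

(** The [k]-th value is at most [y] iff more than [k] of the variables are, and
    there are finitely many choices for the set of these variables. *)
Lemma measurable_nth_sorted_values (n k : nat) (Y : 'I_n -> T -> R) :
  (forall l, measurable_fun [set: T] (Y l)) ->
  measurable_fun [set: T] (fun w => (sorted_values (Y ^~ w))`_k).
Proof.
move=> mY; have [nk|kn] := leqP n k.
  rewrite (_ : (fun _ => _) = cst 0)//.
  by apply/funext => w; rewrite nth_default// size_sorted_values.
have mle y : measurable [set w | (sorted_values (Y ^~ w))`_k <= y].
  rewrite (_ : [set _ | _] =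
    \bigcup_(A in [set A : {set 'I_n} | (k < #|A|)%N])
      [set w | forall l, l \in A -> Y l w <= y]).
    apply: fin_bigcup_measurable => // A _.
    rewrite (_ : [set _ | _] = \bigcap_(l in [set` A]) (Y l @^-1` `]-oo, y])).
      apply: fin_bigcap_measurable => // l _.
      by rewrite -[X in measurable X]setTI; exact: mY.
    by apply/seteqP; split => w /= h l lA; have := h l lA; rewrite /= in_itv.
  apply/seteqP; split => w /=; rewrite nth_sorted_values_le//.
    by move=> kw; exists [set l | (Y l w <= y)%R]%SET => //= l; rewrite inE.
  case=> A /= kA Aw; apply: (leq_trans kA); apply/subset_leq_card/fintype.subsetP.
  by move=> l /Aw; rewrite inE.
apply: (@measurability _ _ _ _ _ _ (@RGenOInfty.G R)).
  exact: RGenOInfty.measurableE.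
move=> _ [_ [y ->] <-]; rewrite setTI -setCitvl preimage_setC; apply: measurableC.
by rewrite [X in measurable X](_ : _ =
  [set w | (sorted_values (Y ^~ w))`_k <= y]).
Qed.

Lemma measurable_spacing_sum_seq (c : seq R) (n : nat) (p : T -> R)
    (s : T -> seq R) : (forall w, size (s w) = n) ->
  measurable_fun [set: T] p ->
  (forall k, measurable_fun [set: T] (fun w => (s w)`_k)) ->
  measurable_fun [set: T] (fun w => spacing_sum c (p w) (s w)).
Proof.
elim: c n p s => [|a c IH] [|n] p s ss mp ms.
- exact: measurable_cst.
- exact: measurable_cst.
- rewrite (_ : (fun _ => _) = cst 0)//.
  by apply/funext => w; move: (ss w) => /size0nil ->.
rewrite (_ : (fun _ => _) = (fun w => a * n.+1%:R * ((s w)`_0 - p w)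
    + spacing_sum c (s w)`_0 (behead (s w)))); last first.
  by apply/funext => w; move: (ss w); case: (s w) => //= z s' [->].
apply: measurable_funD.
  by apply: measurable_funM => //; exact: measurable_funB.
apply: (IH n) => // [w|k]; first by rewrite size_behead ss.
by under eq_fun do rewrite nth_behead; exact: ms.
Qed.

Lemma measurable_spacing_sum (c : seq R) (n : nat) (Y : 'I_n -> T -> R) :
  (forall l, measurable_fun [set: T] (Y l)) ->
  measurable_fun [set: T] (fun w => spacing_sum c 0 (sorted_values (Y ^~ w))).
Proof.
move=> mY; apply: (@measurable_spacing_sum_seq _ n) => // [w|k].
  exact: size_sorted_values.
exact: measurable_nth_sorted_values.
Qed.

End measurability.

(** * Recursion over the minimum *)

Section minimum_decomposition.
Context (d : measure_display) (T : measurableType d) (R : realType).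

Definition after_min (b : bool) (t : R) : set R :=
  [set` Interval (BSide b t) +oo%O].

Lemma after_minE b (t z : R) :
  after_min b t z = (if b then t <= z else t < z) :> Prop.
Proof. by rewrite /after_min/= in_itv/= andbT; case: b. Qed.

Lemma after_min_ge b (t z : R) : after_min b t z -> t <= z.
Proof. by rewrite after_minE; case: b => //; exact: ltW. Qed.

(** [i] is the first index at which the minimum is attained.  With this rule for
    ties exactly one index qualifies at every point of the space, so the space
    is partitioned without exceptional null sets. *)
Definition is_argmin (m : nat) (i : 'I_m.+1) (x : 'I_m.+1 -> R) : Prop :=
  forall l : 'I_m, after_min (i <= l)%N (x i) (x (lift i l)).

Lemma leq_lift_self (m : nat) (i k : 'I_m.+1) (l : 'I_m) : k = lift i l ->
  (i <= l)%N = (i <= k)%N.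
Proof.
move=> ->; rewrite /= /bump; case: (leqP i l) => il; first by rewrite leqW.
by rewrite leqNgt il.
Qed.

Lemma is_argmin_ge (m : nat) (i : 'I_m.+1) (x : 'I_m.+1 -> R) :
  is_argmin i x -> forall k, x i <= x k.
Proof.
by move=> ix k; case: (unliftP i k) => [l ->|->//]; exact: after_min_ge (ix l).
Qed.

Lemma is_argmin_gt (m : nat) (i k : 'I_m.+1) (x : 'I_m.+1 -> R) :
  is_argmin i x -> (k < i)%N -> x i < x k.
Proof.
move=> ix ki; case: (unliftP i k) => [l kl|ki']; last by rewrite ki' ltnn in ki.
by have := ix l; rewrite after_minE (leq_lift_self kl) -kl leqNgt ki.
Qed.

Lemma ex_argmin (m : nat) (x : 'I_m.+1 -> R) : exists i, is_argmin i x.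
Proof.
pose P i := [forall k, x i <= x k].
have [i0 Pi0] : exists i0, P i0.
  have [i0 _ h] := @Order.TotalTheory.arg_minP _ _ _ ord0 xpredT x isT.
  by exists i0; apply/forallP => k; exact: h.
have [i Pi ih] := @arg_minnP _ i0 P (fun i => val i) Pi0.
exists i => l; rewrite after_minE; have /forallP xi := Pi.
case: leqP => // li; rewrite lt_neqAle xi andbT; apply/eqP => xE.
have : P (lift i l) by apply/forallP => k; rewrite -xE.
by move=> /ih; rewrite -(leq_lift_self (erefl _)) leqNgt li.
Qed.

Lemma argmin_uniq (m : nat) (i k : 'I_m.+1) (x : 'I_m.+1 -> R) :
  is_argmin i x -> is_argmin k x -> i = k.
Proof.
move=> ix kx.
case: (ltngtP i k) => [/(is_argmin_gt kx)|/(is_argmin_gt ix)|/val_inj//].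
  by rewrite ltNge (is_argmin_ge ix).
by rewrite ltNge (is_argmin_ge kx).
Qed.

Lemma spacing_sum_argmin (a : R) (c : seq R) (m : nat) (i : 'I_m.+1)
    (x : 'I_m.+1 -> R) : is_argmin i x ->
  spacing_sum (a :: c) 0 (sorted_values x) =
  a * m.+1%:R * x i +
  spacing_sum c 0 (sorted_values (fun l => x (lift i l) - x i)).
Proof.
move=> /is_argmin_ge xi.
rewrite (sorted_values_min xi) /= size_sorted_values subr0.
by congr (_ + _); rewrite (spacing_sum_shift _ _ (x i)) subrr sorted_values_sub.
Qed.

Lemma measurable_le_set d' (T' : measurableType d') (f g : T' -> R) :
  measurable_fun [set: T'] f -> measurable_fun [set: T'] g ->
  measurable [set z | f z <= g z].
Proof.
move=> mf mg; rewrite (_ : [set _ | _] = (fun z => g z - f z) @^-1` `[0, +oo[).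
  by rewrite -[X in measurable X]setTI; exact: measurable_funB.
by apply/seteqP; split => z /=; rewrite in_itv/= andbT subr_ge0.
Qed.

Lemma measurable_after_min d' (T' : measurableType d') b (f g : T' -> R) :
  measurable_fun [set: T'] f -> measurable_fun [set: T'] g ->
  measurable [set z | after_min b (f z) (g z)].
Proof.
move=> mf mg; case: b; under eq_set do rewrite after_minE.
  exact: measurable_le_set.
rewrite (_ : [set _ | _] = ~` [set z | g z <= f z]).
  by apply: measurableC; exact: measurable_le_set.
by apply/seteqP; split => z /=; rewrite ltNge => /negP.
Qed.

Context (r : R) (r_gt0 : 0 < r).

(** The remaining variables, shifted by [t] and restricted to lie after [t],
    form again an exponential sample; only its mass is multiplied by the
    probability that all of them exceed [t]. *)
Lemma exponential_family_memoryless (m : nat)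
    (Q : {finite_measure set T -> \bar R})
    (Y : 'I_m.+1 -> T -> R) (K : R) (i : 'I_m.+1) (t : R)
    (mD : measurable [set w |
       forall l : 'I_m, after_min (i <= l)%N t (Y (lift i l) w)]) :
  exponential_family r Q Y K -> 0 <= t ->
  exponential_family r (mrestr Q mD) (fun l w => Y (lift i l) w - t)
    (K * expR (- (m%:R * r * t))).
Proof.
move=> famY t0; split=> [l|B mB].
  by apply: measurable_funB => //; exact: famY.1.
rewrite /mrestr.
pose B' (l : 'I_m) := after_min (i <= l)%N t `&` [set z | B l (z - t)].
have mB' l : measurable (B' l).
  apply: measurableI; first exact: measurable_itv.
  have mt : measurable_fun [set: measurableTypeR R]
      (fun z : measurableTypeR R => z - t : measurableTypeR R).
    exact: measurable_funB.
  by have := mt measurableT _ (mB l); rewrite setTI.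
have := family_rest_setI r_gt0 famY i measurableT mB'.
rewrite preimage_setT setTI probability_setT mul1e => QB'.
rewrite (_ : _ `&` _ = [set w | forall l, B' l (Y (lift i l) w)]); last first.
  apply/seteqP; split => w /=.
    by case=> h1 h2 l; split; [exact: h2|exact: h1].
  by move=> h; split => l; have [] := h l.
rewrite QB'.
under eq_bigr => l _ do
  rewrite -(exponential_lawE r_gt0)
    (exponential_law_memoryless r_gt0 _ t0 (mB l)) exponential_lawE.
rewrite big_split/= EFinM -muleA; congr (_ * (_ * _))%E.
rewrite prodEFin prodr_const card_ord -expRM_natl; congr (expR _)%:E.
by rewrite -mulrA mulrN.
Qed.

End minimum_decomposition.

Lemma measurable_min_event (d : measure_display) (Z : measurableType d)
    (R : realType) (c : seq R) (a y : R) (m i : nat) (g : Z -> R)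
    (Y : 'I_m -> Z -> R) :
  measurable_fun [set: Z] g -> (forall l, measurable_fun [set: Z] (Y l)) ->
  measurable
    ([set z | spacing_sum c 0 (sorted_values (fun l => Y l z - g z))
              <= - (y + a * g z)] `&`
     [set z | forall l : 'I_m, after_min (i <= l)%N (g z) (Y l z)]).
Proof.
move=> mg mY; apply: measurableI.
  apply: measurable_le_set.
    by apply: measurable_spacing_sum => l; exact: measurable_funB.
  by apply: measurable_funN; apply: measurable_funD => //; exact: measurable_funM.
rewrite (_ : [set _ | _] = \bigcap_(l in [set: 'I_m])
  [set z | after_min (i <= l)%N (g z) (Y l z)]).
  by apply: fin_bigcap_measurable => // l _; exact: measurable_after_min.
by apply/seteqP; split => z /= h l; [move=> _|]; exact: h.
Qed.

Section recursion.
Context (d : measure_display) (T : measurableType d) (R : realType).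
Context (r : R) (r_gt0 : 0 < r).
Local Notation mu := (@lebesgue_measure R).

(** The density [m.+1 * r * exp (- m.+1 * r * t)] of the minimum arises from
    the [m.+1] choices of its index, the density [r * exp (- r * t)] of that
    variable, and the factor [exp (- m * r * t)] of
    [exponential_family_memoryless].  The new level [y + a * m.+1 * t]
    accounts for the first normalized spacing, [m.+1] times the minimum. *)
Lemma spacing_sum_recursion (m : nat) (a : R) (c : seq R)
    (Q : {finite_measure set T -> \bar R}) (Y : 'I_m.+1 -> T -> R) (K y : R)
    (Psi : R -> R) :
  exponential_family r Q Y K ->
  (forall (t : R), 0 < t -> forall (Q' : {finite_measure set T -> \bar R})
     (Y' : 'I_m -> T -> R) (K' : R), exponential_family r Q' Y' K' ->
     Q' [set w | spacing_sum c 0 (sorted_values (Y' ^~ w)) <=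
                 - (y + a * m.+1%:R * t)] = (K' * Psi t)%:E) ->
  Q [set w | spacing_sum (a :: c) 0 (sorted_values (Y ^~ w)) <= - y] =
  (m.+1%:R%:E * \int[mu]_(t in `]0%R, +oo[)
     (K * Psi t * (r * expR (- (m.+1%:R * r * t))))%:E)%E.
Proof.
move=> famY IH.
pose D (i : 'I_m.+1) (t : R) : set T :=
  [set w | forall l : 'I_m, after_min (i <= l)%N t (Y (lift i l) w)].
pose A (i : 'I_m.+1) (t : R) : set T :=
  [set w | spacing_sum c 0 (sorted_values (fun l => Y (lift i l) w - t))
           <= - (y + a * m.+1%:R * t)].
have mD i t : measurable (D i t).
  apply: (measurable_events (B := fun l : 'I_m => after_min (i <= l)%N t)).
    by move=> l; exact: famY.1.
  by move=> l; exact: measurable_itv.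
have QAD i t : 0 < t -> Q (A i t `&` D i t) =
    (K * expR (- (m%:R * r * t)) * Psi t)%:E.
  move=> t0; exact: (IH t t0 _ _ _
    (exponential_family_memoryless r_gt0 (mD i t) famY (ltW t0))).
pose TG (i : 'I_m.+1) := g_sigma_algebraType (rest_events Y i).
pose S i : set (measurableTypeR R * TG i) :=
  [set tw | A i tw.1 tw.2] `&` [set tw | D i tw.1 tw.2].
have mS i : measurable (S i).
  apply: (@measurable_min_event _ (measurableTypeR R * TG i)%type R c (a * m.+1%:R)
    y m i fst (fun l tw => Y (lift i l) tw.2)) => [|l]; first exact: measurable_fst.
  exact: (measurableT_comp (@measurable_rest _ _ _ _ Y i l) measurable_snd).
have QS i : Q [set w | S i (Y i w, w)] = (\int[mu]_(t in `]0%R, +oo[)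
     (K * Psi t * (r * expR (- (m.+1%:R * r * t))))%:E)%E.
  have [mf ->] := family_disintegration r_gt0 famY (mS i).
  have xS t : xsection (S i) t = A i t `&` D i t.
    by apply/seteqP; split => w; rewrite /xsection/= inE.
  rewrite integral_exponential_law; last first.
    apply: (@le_integrable _ _ _ _ _ _ _ (fun=> (fine (Q setT))%:E)) => //.
      move=> t _; rewrite fineK ?fin_num_measure// !gee0_abs//.
      apply: le_measure; rewrite ?inE//.
      rewrite xS; apply: (@measurable_min_event _ T R c (a * m.+1%:R) y m i (fun=> t)
        (fun l => Y (lift i l))) => // l; exact: famY.1.
    exact: finite_measure_integrable_cst.
  transitivity (\int[mu]_(t in `[0%R, +oo[)
      (Q (xsection (S i) t) * (exponential_pdf r t)%:E))%E.
    rewrite [RHS]integral_mkcond; apply: eq_integral => t _.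
    rewrite patchE; case: ifPn => // /negP; rewrite inE/= in_itv/= andbT => /negP.
    by rewrite -ltNge => t0; rewrite lt0_exponential_pdf// mule0.
  rewrite -integral_itv_obnd_cbnd; last first.
    apply: measurable_funTS; apply: emeasurable_funM => //.
    by apply/measurable_EFinP; exact: measurable_exponential_pdf.
  apply: eq_integral => t; rewrite inE/= in_itv/= andbT => t0.
  rewrite xS QAD// exponential_pdfE ?ltW// -EFinM; congr EFin.
  have -> : - (m.+1%:R * r * t) = - (m%:R * r * t) + - r * t.
    by rewrite -natr1; ring.
  by rewrite expRD; ring.
rewrite (_ : [set _ | _] = \big[setU/set0]_(i < m.+1) [set w | S i (Y i w, w)]).
  rewrite measure_bigsetU_ord//; last 2 first.
  - move=> i; apply: (@measurable_min_event _ T R c (a * m.+1%:R) y m i (Y i)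
      (fun l => Y (lift i l))) => [|l]; exact: famY.1.
  - apply/trivIsetP => i k _ _ /eqP ik.
    rewrite -subset0 => w [] [_ /= iw] [_ /= kw].
    by apply: ik; exact: (@argmin_uniq _ _ _ _ (Y ^~ w) iw kw).
  rewrite (eq_bigr _ (fun i _ => QS i)) sumr_const card_ord.
  exact: (esym (mule_natl _ _)).
rewrite -bigcup_pred; apply/seteqP; split => w.
  have [i iw] := ex_argmin (Y ^~ w).
  rewrite /mkset (spacing_sum_argmin a c iw) => h; exists i => //; split => //.
  by rewrite /A/= opprD lerBrDr addrC.
move=> [i _ [h iw]].
have {}iw : is_argmin i (Y ^~ w) by exact: iw.
rewrite /mkset (spacing_sum_argmin a c iw).
by move: h; rewrite /A/= opprD lerBrDr addrC.
Qed.
End recursion.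

(** * Integrals of sums of exponentials *)

Section exponential_integrals.
Context (R : realType).
Local Notation mu := (@lebesgue_measure R).

Lemma integral_exponential (k rho : R) (D : set (measurableTypeR R)) :
  0 < rho -> measurable D ->
  D `<=` `[0, +oo[%classic ->
  mu.-integrable D (fun t => (k * expR (- (rho * t)))%:E) /\
  (\int[mu]_(t in D) (k * expR (- (rho * t)))%:E =
   (k / rho)%:E * exponential_prob rho D)%E.
Proof.
move=> rho0 mD D0.
have eqD t : t \in D ->
    (k * expR (- (rho * t)))%:E = ((k / rho)%:E * (exponential_pdf rho t)%:E)%E.
  rewrite inE => /D0 /=; rewrite in_itv/= andbT => t0.
  by rewrite exponential_pdfE// -EFinM -mulNr -mulrA mulKf ?gt_eqF.
have intD : mu.-integrable D (EFin \o exponential_pdf rho).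
  by apply: (integrableS measurableT) => //; exact: integrable_exponential_pdf.
split; last first.
  transitivity (\int[mu]_(t in D) ((k / rho)%:E * (exponential_pdf rho t)%:E))%E.
    exact: eq_integral.
  exact: integralZl.
have := integrableZl mD (k / rho) intD.
by apply: eq_integrable => // t /eqD ->.
Qed.

Lemma integral_exponential_sum (s : seq R) (P : pred R) (k rho : R -> R)
    (D : set (measurableTypeR R)) :
  (forall b, b \in s -> P b -> 0 < rho b) -> measurable D ->
  D `<=` `[0, +oo[%classic ->
  (\int[mu]_(t in D) (\sum_(b <- s | P b) k b * expR (- (rho b * t)))%:E =
   \sum_(b <- s | P b) (k b / rho b)%:E * exponential_prob (rho b) D)%E.
Proof.
move=> rho0 mD D0.
(* [integral_sum] asks for integrability at every index, in [s] or not. *)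
pose rho' b := if 0 < rho b then rho b else 1.
have rho'0 b : 0 < rho' b by rewrite /rho'; case: ifP.
have rhoE b : (b \in s) && P b -> rho b = rho' b.
  by move=> /andP[bs Pb]; rewrite /rho' rho0.
transitivity (\int[mu]_(t in D)
    \sum_(b <- s | P b) (k b * expR (- (rho' b * t)))%:E)%E.
  apply: eq_integral => t _; rewrite sumEFin; congr EFin.
  by rewrite big_seq_cond [RHS]big_seq_cond; apply: eq_bigr => b /rhoE ->.
rewrite integral_sum//; last first.
  by move=> b; have [] := integral_exponential (k b) (rho'0 b) mD D0.
rewrite big_seq_cond [RHS]big_seq_cond; apply: eq_bigr => b /rhoE ->.
by have [] := integral_exponential (k b) (rho'0 b) mD D0.
Qed.

Lemma exponential_prob_0y (rho : R) : 0 < rho ->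
  exponential_prob rho `]0, +oo[%classic = 1%E.
Proof.
move=> rho0; rewrite -(exponential_lawE rho0) exponential_law_oy//.
by rewrite mulr0 oppr0 expR0.
Qed.

Lemma exponential_prob_cy (rho s : R) : 0 < rho -> 0 <= s ->
  exponential_prob rho `[s, +oo[%classic = (expR (- (rho * s)))%:E.
Proof. by move=> rho0 s0; rewrite -(exponential_lawE rho0) exponential_law_cy. Qed.

Lemma exponential_prob_0o (rho s : R) : 0 < rho -> 0 < s ->
  exponential_prob rho `]0, s[%classic = (1 - expR (- (rho * s)))%:E.
Proof.
move=> rho0 s0.
have : exponential_law rho0 (`]0, s[%classic `|` `[s, +oo[%classic) =
    (exponential_law rho0 `]0%R, s[%classic + exponential_law rho0 `[s, +oo[%classic)%E.
  apply: measureU => //; apply/seteqP; split => // t /=; rewrite !in_itv/= andbT.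
  by case=> /andP[_ ts]; rewrite leNgt ts.
have s0' := ltW s0; rewrite -itv_bndbnd_setU ?bnd_simp//.
rewrite !exponential_lawE exponential_prob_0y// (exponential_prob_cy rho0 (ltW s0)).
by rewrite EFinB => ->; rewrite addeK.
Qed.
End exponential_integrals.

(** * The lower tail for decreasing coefficients *)

Section hypoexponential_tail.
Context (d : measure_display) (T : measurableType d) (R : realType).
Context (r : R) (r_gt0 : 0 < r).
Local Notation mu := (@lebesgue_measure R).

Lemma exponential_family_setT (m : nat) (Q : {finite_measure set T -> \bar R})
    (Y : 'I_m -> T -> R) (K : R) : exponential_family r Q Y K -> Q setT = K%:E.
Proof.
move=> famY; have /= := famY.2 (fun=> setT) (fun=> measurableT).
rewrite big1 ?mule1 => [<-|l _]; first by congr (Q _); apply/seteqP; split.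
by rewrite -(exponential_lawE r_gt0) probability_setT.
Qed.

Lemma exponential_family_ge0 (m : nat) (Q : {finite_measure set T -> \bar R})
    (Y : 'I_m -> T -> R) (K : R) : exponential_family r Q Y K ->
  Q [set w | forall l, 0 <= Y l w] = K%:E.
Proof.
move=> famY; have /= := famY.2 (fun=> `[0, +oo[%classic) (fun=> measurable_itv _).
rewrite big1 ?mule1 => [<-|l _].
  by congr (Q _); apply/seteqP; split => w /= h l; have := h l; rewrite in_itv/= andbT.
by rewrite -(exponential_lawE r_gt0) exponential_law_c0y.
Qed.

(** Almost surely the sample is nonnegative, and then so are its spacings. *)
Lemma spacing_sum_nonpos_law (m : nat) (c : seq R)
    (Q : {finite_measure set T -> \bar R}) (Y : 'I_m -> T -> R) (K z : R) :
  exponential_family r Q Y K -> all (<= 0) c -> 0 <= z ->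
  Q [set w | spacing_sum c 0 (sorted_values (Y ^~ w)) <= z] = K%:E.
Proof.
move=> famY c0 z0; have mYl := famY.1.
have mge : measurable [set w | forall l, 0 <= Y l w].
  rewrite (_ : [set _ | _] = [set w | forall l, `[0, +oo[%classic (Y l w)]).
    exact: (measurable_events (B := fun=> `[0, +oo[%classic)).
  by apply/seteqP; split => w /= h l; have := h l; rewrite in_itv/= andbT.
have ms : measurable [set w | spacing_sum c 0 (sorted_values (Y ^~ w)) <= z].
  by apply: measurable_le_set => //; exact: measurable_spacing_sum.
apply/eqP; rewrite eq_le; apply/andP; split.
  by rewrite -(exponential_family_setT famY); apply: le_measure; rewrite ?inE.
rewrite -(exponential_family_ge0 famY); apply: le_measure; rewrite ?inE// => w /= Y0.
apply: le_trans z0; apply: spacing_sum_le0 => //.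
rewrite path_min_sorted; first exact/sort_sorted/le_total.
by apply/allP => u; rewrite mem_sort => /codomP[l ->].
Qed.

Definition hypoexp_tail (c : seq R) (y : R) : R :=
  \sum_(b <- c | b < 0) hypoexp_weight c b * expR (r * y / b).

Definition tail_formula (m : nat) (c : seq R) : Prop :=
  forall (Q : {finite_measure set T -> \bar R}) (Y : 'I_m -> T -> R) (K y : R),
  0 < y -> exponential_family r Q Y K ->
  Q [set w | spacing_sum c 0 (sorted_values (Y ^~ w)) <= - y] =
  (K * hypoexp_tail c y)%:E.

(** The exponential of scale [b], evaluated at a level that is affine in [t]
    and multiplied by the density of the minimum, is again an exponential in
    [t]. *)
Lemma hypoexp_tail_density (a K y M t : R) (c : seq R) :
  K * hypoexp_tail c (y + a * M * t) * (r * expR (- (M * r * t))) =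
  \sum_(b <- c | b < 0) K * hypoexp_weight c b * expR (r * y / b) * r *
    expR (- (M * r * (1 - a / b) * t)).
Proof.
rewrite /hypoexp_tail mulr_sumr mulr_suml; apply: eq_bigr => b b0.
have E : expR (r * (y + a * M * t) / b) * (r * expR (- (M * r * t))) =
    expR (r * y / b) * r * expR (- (M * r * (1 - a / b) * t)).
  rewrite mulrCA -expRD [RHS]mulrAC -expRD mulrC; congr (expR _ * r).
  by field; rewrite lt_eqF.
transitivity (K * hypoexp_weight c b *
    (expR (r * (y + a * M * t) / b) * (r * expR (- (M * r * t)))));
  first by ring.
by rewrite E; ring.
Qed.

(** For [a >= 0] and [b < 0] the rate [rho b] is positive and [k b / rho b]
    equals [K * hypoexp_weight (a :: c) b * expR (r * y / b) / M], the factor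
    [1 / (1 - a / b)] being the one that [hypoexp_weight] gains from [a].  The
    level [y = 0] is allowed when [a > 0], since the minimum, positive almost
    surely, makes the next level positive. *)
Lemma spacing_sum_step_ge0 (m : nat) (a : R) (c : seq R)
    (Q : {finite_measure set T -> \bar R}) (Y : 'I_m.+1 -> T -> R) (K y : R) :
  tail_formula m c -> exponential_family r Q Y K ->
  0 <= a -> 0 <= y -> 0 < y \/ 0 < a ->
  Q [set w | spacing_sum (a :: c) 0 (sorted_values (Y ^~ w)) <= - y] =
  (K * hypoexp_tail (a :: c) y)%:E.
Proof.
move=> IH famY a0 y0 ya.
pose M : R := m.+1%:R.
have M0 : 0 < M by rewrite ltr0n.
have rn0 : r != 0 by rewrite gt_eqF.
rewrite (@spacing_sum_recursion _ T R r r_gt0 m a c Q Y K y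
  (fun t => hypoexp_tail c (y + a * M * t)) famY); last first.
  move=> t t0 Q' Y' K' famY'; apply: IH => //; case: ya => [y1|a1].
    by rewrite (lt_le_trans y1)// lerDl !mulr_ge0// ltW.
  by rewrite (le_lt_trans y0)// ltrDl !mulr_gt0.
pose k b := K * hypoexp_weight c b * expR (r * y / b) * r.
pose rho b := M * r * (1 - a / b).
have rho0 b : b < 0 -> 0 < rho b.
  move=> b0; rewrite /rho !mulr_gt0// subr_gt0 (le_lt_trans _ ltr01)//.
  by rewrite mulr_ge0_le0// invr_le0 ltW.
transitivity (M%:E * \int[mu]_(t in `]0%R, +oo[)
    (\sum_(b <- c | b < 0) k b * expR (- (rho b * t)))%:E)%E.
  congr (_ * _)%E; apply: eq_integral => t _; congr EFin.
  exact: hypoexp_tail_density.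
rewrite integral_exponential_sum//; first last.
- by move=> t /=; rewrite !in_itv/= !andbT; exact: ltW.
- by move=> b _; exact: rho0.
rewrite (eq_bigr (fun b => (k b / rho b)%:E)) => [|b b0]; last first.
  by rewrite exponential_prob_0y ?rho0// mule1.
rewrite sumEFin -EFinM; congr EFin.
rewrite /hypoexp_tail big_cons ltNge a0/= !mulr_sumr; apply: eq_bigr => b b0.
have ab : a != b by rewrite gt_eqF// (lt_le_trans b0).
rewrite hypoexp_weight_cons// /k /rho; field.
by rewrite rn0 (lt_eqF b0) subr_eq0 (eq_sym b) ab nat1r pnatr_eq0.
Qed.

(** For [a < 0] all coefficients are negative.  Once the minimum reaches
    [s = - y / (a * M)], the first spacing alone brings the sum down to [- y]
    and the event becomes certain; before [s] the tail formula for [c]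
    applies.  At [s] the products of [expR (r * y / b)] and
    [expR (- (rho b * s))] have the common value [expR (r * y / a)]. *)
Lemma spacing_sum_step_lt0 (m : nat) (a : R) (c : seq R)
    (Q : {finite_measure set T -> \bar R}) (Y : 'I_m.+1 -> T -> R) (K y : R) :
  tail_formula m c -> exponential_family r Q Y K ->
  a < 0 -> all (< a) c -> uniq c -> 0 < y ->
  Q [set w | spacing_sum (a :: c) 0 (sorted_values (Y ^~ w)) <= - y] =
  (K * hypoexp_tail (a :: c) y)%:E.
Proof.
move=> IH famY a0 /allP ca uc y0.
pose M : R := m.+1%:R.
have M0 : 0 < M by rewrite ltr0n.
have Mn0 : M != 0 by rewrite gt_eqF.
have rn0 : r != 0 by rewrite gt_eqF.
have an0 : a != 0 by rewrite lt_eqF.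
have c0 b : b \in c -> b < 0 by move=> /ca /= ba; exact: lt_trans ba a0.
pose s := - (y / (a * M)).
have s0 : 0 < s by rewrite oppr_gt0 pmulr_rlt0// invr_lt0 nmulr_rlt0.
have sE t : (t < s) = (0 < y + a * M * t).
  rewrite -(ltr_nM2l (x := a * M)) ?nmulr_rlt0//.
  rewrite /s mulrN mulrCA divff ?mulr1; last by rewrite mulf_neq0.
  by rewrite -subr_gt0 opprK addrC.
rewrite (@spacing_sum_recursion _ T R r r_gt0 m a c Q Y K y
  (fun t => if t < s then hypoexp_tail c (y + a * M * t) else 1) famY); last first.
  move=> t t0 Q' Y' K' famY'; case: ifPn; rewrite sE => yt; first exact: IH.
  rewrite mulr1; apply: spacing_sum_nonpos_law famY' _ _.
    by apply/allP => b /c0 /ltW.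
  by rewrite oppr_ge0 leNgt.
pose k b := K * hypoexp_weight c b * expR (r * y / b) * r.
pose rho b := M * r * (1 - a / b).
have rho0 b : b \in c -> 0 < rho b.
  move=> bc; rewrite /rho !mulr_gt0// subr_gt0 ltr_ndivrMr ?c0// mul1r.
  exact: ca.
have s0' := ltW s0.
rewrite (@itv_bndbnd_setU _ _ (BRight 0) (BLeft s) +oo%O) ?bnd_simp//.
rewrite integral_setU//; last 2 first.
- apply: measurable_funTS; apply/measurable_EFinP.
  have me (f : R -> R) : measurable_fun setT f ->
      measurable_fun setT (fun t => expR (f t)).
    by move=> mf; apply: (measurableT_comp _ mf); exact: measurable_expR.
  apply: measurable_funM; last first.
    apply: measurable_funM => //; apply: me; apply: measurable_funN.
    exact: measurable_funM.
  apply: measurable_funM => //; apply: measurable_fun_ifT => //.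
    exact: measurable_fun_ltr.
  rewrite /hypoexp_tail; under eq_fun do rewrite big_mkcond.
  apply: measurable_sum => b; case: (b < 0) => //.
  apply: measurable_funM => //; apply: me.
  apply: measurable_funM => //; apply: measurable_funM => //.
  by apply: measurable_funD => //; exact: measurable_funM.
- apply/disj_setPS => t [] /=; rewrite !in_itv/= andbT => /andP[_ ts].
  by rewrite leNgt ts.
have -> : (\int[mu]_(t in `]0%R, s[) (K * (if t < s then
      hypoexp_tail c (y + a * M * t) else 1) * (r * expR (- (M * r * t))))%:E =
   \int[mu]_(t in `]0%R, s[)
      (\sum_(b <- c | b < 0) k b * expR (- (rho b * t)))%:E)%E.
  apply: eq_integral => t; rewrite inE/= in_itv/= => /andP[_ ->]; congr EFin.
  exact: hypoexp_tail_density.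
have -> : (\int[mu]_(t in `[s, +oo[) (K * (if t < s then
      hypoexp_tail c (y + a * M * t) else 1) * (r * expR (- (M * r * t))))%:E =
   \int[mu]_(t in `[s, +oo[) (K * r * expR (- (M * r * t)))%:E)%E.
  apply: eq_integral => t; rewrite inE/= in_itv/= andbT ltNge => ->.
  by rewrite /= mulr1 mulrA.
have Mr0 : 0 < M * r by rewrite mulr_gt0.
rewrite integral_exponential_sum//; first last.
- by move=> t /=; rewrite !in_itv/= !andbT => /andP[/ltW].
- by move=> b bc _; exact: rho0.
have sy0 : `[s, +oo[%classic `<=` `[0, +oo[%classic.
  by move=> t /=; rewrite !in_itv/= !andbT; exact: le_trans.
have [_ ->] := integral_exponential (K * r) Mr0 (measurable_itv _) sy0.
rewrite exponential_prob_cy//.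
have expE b : b < 0 -> expR (- (rho b * s)) = expR (r * y / a - r * y / b).
  move=> b0; congr expR; rewrite /rho /s; field.
  by rewrite an0 nat1r pnatr_eq0 lt_eqF.
have expMs : expR (- (M * r * s)) = expR (r * y / a).
  by congr expR; rewrite /s; field; rewrite an0 nat1r pnatr_eq0.
rewrite big_seq_cond (eq_bigr (fun b => (k b / rho b *
    (1 - expR (r * y / a - r * y / b)))%:E)); last first.
  move=> b /andP[bc _].
  by rewrite exponential_prob_0o ?rho0// expE ?c0// EFinM.
rewrite -big_seq_cond sumEFin.
rewrite -[X in (_ * (_ + X))%E]EFinM -EFinD -EFinM expMs; congr EFin.
have nac : a \notin c by apply/negP => /ca; rewrite /= ltxx.
have cE : \sum_(b <- c | b < 0) hypoexp_weight (a :: c) b =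
    \sum_(b <- c) hypoexp_weight (a :: c) b.
  rewrite big_seq_cond [RHS]big_seq; apply: eq_bigl => b.
  by case: (boolP (b \in c)) => //= /c0 ->.
(* The leftover coefficient of [expR (r * y / a)] is the weight of [a]. *)
have W : hypoexp_weight (a :: c) a =
    1 - \sum_(b <- c | b < 0) hypoexp_weight (a :: c) b.
  by rewrite cE -(@hypoexp_weight_sum _ (a :: c)) ?big_cons ?addrK//= nac.
rewrite /hypoexp_tail big_cons a0 W mulrBl mul1r mulr_suml -addrA -sumrN.
rewrite -big_split/=.
rewrite mulrDr mulrDr addrC mulr_sumr mulr_sumr; congr (_ + _).
  by field; rewrite rn0 nat1r pnatr_eq0.
rewrite big_seq_cond [RHS]big_seq_cond; apply: eq_bigr => b /andP[bc _].
have ab : a != b by apply: contraNneq nac => ->.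
rewrite hypoexp_weight_cons// expRD expRN /k /rho; field.
rewrite subr_eq0 eq_sym ab gt_eqF ?expR_gt0// (lt_eqF (c0 _ bc)) rn0 nat1r.
by rewrite pnatr_eq0.
Qed.

Lemma spacing_sum_tail (m : nat) (c : seq R) :
  size c = m -> sorted >%R c -> tail_formula m c.
Proof.
elim: m c => [|m IHm] [|a c] //=.
  move=> _ _ Q Y K y y0 famY; rewrite /hypoexp_tail big_nil mulr0.
  rewrite (_ : [set _ | _] = set0) ?measure0//.
  by apply/seteqP; split => // w /=; rewrite leNgt oppr_lt0 y0.
move=> [cm] ac Q Y K y y0 famY.
have gt_trans : transitive (>%R : rel R).
  by move=> u v w /= vu wv; exact: lt_trans wv vu.
have /andP[ca sc] : all (< a) c && sorted >%R c by rewrite -path_sortedE.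
have IH := IHm c cm sc.
have [a0|a0] := leP 0 a.
  by apply: spacing_sum_step_ge0 => //; [exact: ltW|left].
by apply: spacing_sum_step_lt0 => //; apply: sorted_uniq sc => // u /=; exact: ltxx.
Qed.

(** The weight of a coefficient 0 vanishes because another coefficient [a] is
    nonzero, so only the positive and the negative ones share the total
    weight 1. *)
Lemma hypoexp_tail0 (a : R) (c : seq R) : uniq (a :: c) -> 0 < a ->
  hypoexp_tail (a :: c) 0 =
  1 - \sum_(b <- a :: c | 0 < b) hypoexp_weight (a :: c) b.
Proof.
move=> uc a0; have W := hypoexp_weight_sum uc isT.
rewrite -W (bigID (fun b => 0 < b))/= addrAC subrr add0r.
rewrite [RHS](bigID (fun b => b < 0))/= [X in _ + X]big1 ?addr0.
  apply: eq_big => [b|b _]; last by rewrite mulr0 mul0r expR0 mulr1.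
  by case: ltgtP.
move=> b /andP[]; rewrite -!leNgt => b0 b0'.
have -> : b = 0 by apply/eqP; rewrite eq_le b0.
by rewrite hypoexp_weight_cons ?mul0r// gt_eqF.
Qed.

Lemma spacing_sum_le0_prob (m : nat) (a : R) (c : seq R)
    (Q : {finite_measure set T -> \bar R}) (Y : 'I_m.+1 -> T -> R) (K : R) :
  exponential_family r Q Y K -> size c = m -> sorted >%R (a :: c) ->
  Q [set w | spacing_sum (a :: c) 0 (sorted_values (Y ^~ w)) <= 0] =
  (K * (1 - \sum_(b <- a :: c | 0 < b) hypoexp_weight (a :: c) b))%:E.
Proof.
move=> famY cm sc.
have gt_trans : transitive (>%R : rel R).
  by move=> u v w /= vu wv; exact: lt_trans wv vu.
have uc : uniq (a :: c) by apply: sorted_uniq sc => // u /=; exact: ltxx.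
have /andP[/allP ca sc'] : all (< a) c && sorted >%R c by rewrite -path_sortedE.
have [a0|a0] := leP a 0.
  have c0 b : b \in a :: c -> b <= 0.
    by rewrite inE => /orP[/eqP->//|/ca/= /ltW ba]; exact: le_trans ba a0.
  rewrite (spacing_sum_nonpos_law famY)//; last by apply/allP => b /c0.
  rewrite big_seq_cond big1 ?subr0 ?mulr1// => b /andP[/c0].
  by rewrite leNgt => /negP b0 b0'; case: b0.
rewrite -(hypoexp_tail0 uc a0).
have := @spacing_sum_step_ge0 m a c Q Y K 0.
rewrite oppr0; apply => //; [|exact: ltW|by right].
exact: spacing_sum_tail.
Qed.

End hypoexponential_tail.

(** * The statistic as a combination of spacings *)

Lemma spacing_sum_by_parts (R : realType) (f : nat -> R) (m i : nat) (p : R)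
    (s : seq R) : size s = m ->
  spacing_sum [seq f k | k <- iota i m] p s =
  \sum_(l < m) s`_l * (f (i + l)%N * (m - l)%:R - f (i + l).+1 * (m - l.+1)%:R)
  - p * f i * m%:R.
Proof.
elim: m i p s => [|m IH] i p [|z s] //=.
  by rewrite big_ord0 mulr0 subr0.
move=> [sm]; rewrite (IH i.+1)// big_ord_recl/= addn0 subn0 subSS subn0 sm.
rewrite [in RHS](eq_bigr (fun l : 'I_m => s`_l *
  (f (i.+1 + l)%N * (m - l)%:R - f (i.+1 + l).+1 * (m - l.+1)%:R))).
  by ring.
by move=> l _; rewrite /= /bump/= add1n subSS addnS addSn.
Qed.

Section gamma_spacings.
Context (R : realType) (j : R) (n : nat).
Hypotheses (j_gt0 : 0 < j) (n_gt0 : (0 < n)%N).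

Lemma e_coef_decreasing (k l : nat) :
  (k < l <= n)%N -> e_coef j n l < e_coef j n k.
Proof.
move=> /andP[kl ln]; rewrite /e_coef ltrD2r ltr_pM2l ?invr_gt0//.
apply: gt0_ltr_powR => //; rewrite ?nnegrE ?divr_ge0//.
by rewrite ltr_pM2r ?invr_gt0 ?ltr0n// ltr_nat ltn_add2r ltn_sub2l// (leq_trans kl).
Qed.

Lemma gamma_coefE (k : nat) : (1 <= k <= n)%N ->
  e_coef j n k * (n - k + 1)%:R - e_coef j n k.+1 * (n - k)%:R =
  n%:R * (j^-1 * (((n - k + 1)%:R / n%:R) `^ (j + 1)
             - ((n - k)%:R / n%:R) `^ (j + 1))
     - (j * (j + 1) * n%:R)^-1).
Proof.
move=> /andP[k1 kn].
have nn0 : n%:R != 0 :> R by rewrite pnatr_eq0 -lt0n.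
have powE (u : R) : 0 <= u -> u `^ (j + 1) = u `^ j * u.
  move=> u0; rewrite powRD ?powRr1//.
  by rewrite gt_eqF// addr_gt0.
(* At [k = n] the truncated [n - k.+1] spoils the first factor, but the second
   one is 0. *)
have e2 : e_coef j n k.+1 * (n - k)%:R =
    (j^-1 * ((n - k)%:R / n%:R) `^ j - (j * (j + 1))^-1) * (n - k)%:R.
  have [->|nk] := eqVneq k n; first by rewrite subnn !mulr0.
  rewrite /e_coef; congr ((_ * (_%:R / _) `^ _ - _) * _).
  by rewrite addn1 subnSK// ltn_neqAle nk.
rewrite e2 !powE ?divr_ge0// /e_coef natrD; field.
by rewrite nn0 !gt_eqF ?addr_gt0.
Qed.

Lemma sum_sorted_values (x : 'I_n -> R) :
  \sum_(l < n) (sorted_values x)`_l = \sum_(i < n) x i.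
Proof.
transitivity (\sum_(z <- sorted_values x) z).
  by rewrite (big_nth 0) size_sorted_values big_mkord.
by rewrite (perm_big _ (permEl (perm_sort _ _))) codomE big_map big_enum.
Qed.

Lemma spacing_sum_gamma (x : 'I_n -> R) (y : R) :
  spacing_sum [seq e_coef j n k - y | k <- iota 1 n] 0 (sorted_values x) =
  n%:R * (gamma_stat j x - y * sample_mean x).
Proof.
rewrite (spacing_sum_by_parts (fun k => e_coef j n k - y)) ?size_sorted_values//.
rewrite mul0r mul0r subr0 mulrBr.
have -> : n%:R * (y * sample_mean x) = y * \sum_(l < n) (sorted_values x)`_l.
  rewrite sum_sorted_values /sample_mean mulrCA; congr (_ * _).
  by rewrite mulrC divfK ?pnatr_eq0 -?lt0n.
rewrite /gamma_stat big_add1 big_mkord mulr_sumr mulr_sumr -sumrB.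
apply: eq_bigr => l _; rewrite add1n.
have ln := ltn_ord l.
have -> : (n - l)%N = (n - l.+1 + 1)%N by rewrite addn1 subnSK.
rewrite /order_stat -/(sorted_values x) [RHS](_ : _ = (sorted_values x)`_l *
   (n%:R * (j^-1 * (((n - l.+1 + 1)%:R / n%:R) `^ (j + 1)
             - ((n - l.+1)%:R / n%:R) `^ (j + 1))
     - (j * (j + 1) * n%:R)^-1) - y)); last by rewrite /=; ring.
rewrite -gamma_coefE//; congr (_ * _).
by rewrite natrD; ring.
Qed.

Lemma gamma_star_le (x : 'I_n -> R) (y : R) : (forall i, 0 < x i) ->
  (gamma_star j x <= y) =
  (spacing_sum [seq e_coef j n k - y | k <- iota 1 n] 0 (sorted_values x) <= 0).
Proof.
move=> x0; have m0 : 0 < sample_mean x.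
  rewrite divr_gt0 ?ltr0n//; case: n n_gt0 x x0 => // m _ x x0.
  by rewrite big_ord_recl ltr_pwDl// sumr_ge0// => i _; exact: ltW.
by rewrite spacing_sum_gamma pmulr_rle0 ?ltr0n// subr_le0 /gamma_star ler_pdivrMr.
Qed.

End gamma_spacings.

(** Clearing the denominator turns the event into comparisons of measurable
    functions, separately for each sign of the mean; for mean 0 the quotient
    is 0. *)
Lemma measurable_gamma_star (d : measure_display) (T : measurableType d)
    (R : realType) (j y : R) (n : nat) (X : 'I_n -> T -> R) :
  (forall i, measurable_fun [set: T] (X i)) ->
  measurable [set w | gamma_star j (fun i => X i w) <= y].
Proof.
move=> mX.
pose g w := gamma_stat j (fun i => X i w).
pose m w := sample_mean (fun i => X i w).
have mg : measurable_fun [set: T] g.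
  rewrite /g /gamma_stat; apply: measurable_sum => k.
  by apply: measurable_funM => //; exact: measurable_nth_sorted_values.
have mm : measurable_fun [set: T] m.
  by apply: measurable_funM => //; exact: measurable_sum.
have mym : measurable_fun [set: T] (fun w => y * m w) by exact: measurable_funM.
have m0 : measurable_fun [set: T] (fun _ => 0 : R) by [].
rewrite (_ : [set _ | _] =
    ((~` [set w | m w <= 0]) `&` [set w | g w <= y * m w]) `|`
    ((~` [set w | 0 <= m w]) `&` [set w | y * m w <= g w]) `|`
    ([set w | m w <= 0] `&` [set w | 0 <= m w] `&` [set w | 0 <= y])).
  apply: measurableU; first apply: measurableU; apply: measurableI;
    do ?[exact: measurable_le_set | apply: measurableC; exact: measurable_le_set].
  by apply: measurableI; exact: measurable_le_set.
apply/seteqP; split => w /=; rewrite /gamma_star -/(g w) -/(m w).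
  have [mw|mw|mw] := ltgtP (m w) 0.
  - rewrite ler_ndivrMr// => h; left; right.
    by split => //; apply/negP; rewrite -ltNge.
  - rewrite ler_pdivrMr// => h; left; left.
    by split => //; apply/negP; rewrite -ltNge.
  - by rewrite mw invr0 mulr0 => h; right.
case=> [[[/negP mw h]|[/negP mw h]]|[[m1 m2] h]].
- by rewrite ler_pdivrMr// ltNge.
- by rewrite ler_ndivrMr// ltNge.
- by rewrite (_ : m w = 0) ?invr0 ?mulr0//; apply/eqP; rewrite eq_le m1.
Qed.

(** * Independent exponential observations *)

Section iid_exponential.
Context (R : realType) (d : measure_display) (T : measurableType d).
Context (P : probability T R) (r : R) (r_gt0 : 0 < r).

(** The distribution function is given on the positive half-line only; its
    limit 0 at 0 forces it to vanish on the rest. *)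
Lemma distribution_exponential (X : {RV P >-> R}) :
  (forall x, 0 < x -> cdf X x = (1 - expR (- (r * x)))%:E) ->
  forall B, measurable B -> P (X @^-1` B) = exponential_prob r B.
Proof.
move=> X_cdf B mB.
have cdf0 x : x <= 0 -> cdf X x = 0%E.
  move=> x0; apply/eqP; rewrite eq_le cdf_ge0 andbT; apply/lee_addgt0Pr => e e0.
  rewrite add0e; set y := e / r.
  have y0 : 0 < y by rewrite divr_gt0.
  rewrite (le_trans (cdf_nondecreasing _ (le_trans x0 (ltW y0))))// X_cdf//.
  have := expR_ge1Dx (- (r * y)).
  rewrite /y mulrC divfK ?gt_eqF// lee_fin; lra.
have mX : measurable_fun [set: T] (X : T -> measurableTypeR R).
  exact: measurable_funP X.
have [mX' mX'E] : {m : {measure set (measurableTypeR R) -> \bar R} |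
    forall A, m A = P (X @^-1` A)}.
  by unshelve refine (exist _
    (pushforward P (X : T -> measurableTypeR R) : {measure set _ -> \bar R}) _).
rewrite -mX'E -(exponential_lawE r_gt0).
apply: finite_measure_tail_unique => // [|x].
  by rewrite mX'E preimage_setT probability_setT ltry.
rewrite mX'E -setCitvl preimage_setC.
have mXx : measurable (X @^-1` `]-oo, x]%classic).
  by rewrite -[X in measurable X]setTI; exact: mX.
rewrite probability_setC//.
have mx : measurable (`]-oo, x]%classic : set (measurableTypeR R)).
  exact: measurable_itv.
apply: etrans (esym (probability_setC (exponential_law r_gt0) mx)).
congr (1 - _)%E; rewrite -[LHS]/(cdf X x).
have [x0|x0] := leP x 0.
  by rewrite cdf0//; apply/esym; exact: exponential_law_Nyc0.
by rewrite X_cdf//; apply/esym; exact/exponential_law_Nyc/ltW.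
Qed.

Lemma iid_exponential_family (n : nat) (X : 'I_n -> {RV P >-> R}) :
  mutually_independent X ->
  (forall i x, 0 < x -> cdf (X i) x = (1 - expR (- (r * x)))%:E) ->
  exponential_family r P (fun i => X i : T -> R) 1.
Proof.
move=> indX X_cdf; split => // B mB.
have := indX [set: 'I_n]%SET B mB.
rewrite mul1e (eq_bigl xpredT) => [|i]; last by rewrite inE.
rewrite (eq_bigr _ (fun i _ => distribution_exponential (X_cdf i) (mB i))) => <-.
by congr (P _); apply/seteqP; split => w /= h i; [move=> _|apply: h; rewrite inE].
Qed.

Lemma exponential_family_positive (n : nat) (X : 'I_n -> T -> R) (A : set T) :
  exponential_family r P X 1 -> measurable A ->
  P A = P (A `&` [set w | forall i, 0 < X i w]).
Proof.
move=> famX mA; pose G := [set w | forall i, 0 < X i w].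
have mX := famX.1.
have GE : G = [set w | forall i, `]0, +oo[%classic (X i w)].
  by apply/seteqP; split => w /= h i; have := h i; rewrite in_itv/= andbT.
have mG : measurable G.
  rewrite GE; exact: (measurable_events (B := fun=> `]0, +oo[%classic)).
have PG : P G = 1%E.
  rewrite GE; apply: etrans (famX.2 (fun=> `]0, +oo[%classic) _) _ => //.
  by rewrite big1 ?mule1// => i _; exact: exponential_prob_0y.
rewrite -[LHS]/(P A) (measureDI P mA mG) [X in (X + _)%E](_ : _ = 0%E) ?add0e//.
apply: (@subset_measure0 _ _ _ P _ (~` G)) => //.
- exact: measurableD.
- exact: measurableC.
- by apply: etrans (probability_setC _ mG) _; rewrite PG subee.
Qed.

End iid_exponential.

Theorem theorem1 (R : realType) (d : measure_display) (T : measurableType d)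
    (P : probability T R) (j : R) (n : nat) (X : 'I_n -> {RV P >-> R})
    (j_gt0 : 0 < j) (n_ge1 : (1 <= n)%N)
    (X_indep : mutually_independent X)
    (X_cdf : forall (i : 'I_n) (x : R), 0 < x ->
       cdf (X i) x = (1 - expR (- (x / 2)))%:E)
    (e_distinct : forall i k : nat, (1 <= i <= n)%N -> (1 <= k <= n)%N ->
       i != k -> e_coef j n i != e_coef j n k)
    (x : R) :
  P [set w | gamma_star j (fun i => X i w) <= x] =
  (1 - \sum_(1 <= i < n.+1)
         (\prod_(1 <= k < n.+1 | k != i)
            ((e_coef j n i - x) / (e_coef j n i - e_coef j n k)))
         * ind_lt x (e_coef j n i))%:E.
Proof.
have r_gt0 : 0 < 2^-1 :> R by rewrite invr_gt0.
have famX : exponential_family 2^-1 P (fun i => X i : T -> R) 1.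
  apply: (iid_exponential_family r_gt0) => // i y y0.
  by rewrite X_cdf// mulrC.
have mX := famX.1.
pose c := [seq e_coef j n k - x | k <- iota 1 n].
have sc : sorted >%R c.
  rewrite /c sorted_map; apply: (@sub_in_sorted _ (fun k => 1 <= k <= n)%N ltn).
  - move=> k l /= /andP[k1 kn] /andP[l1 ln] kl.
    by rewrite ltrD2r e_coef_decreasing// kl.
  - by apply/allP => k; rewrite mem_iota add1n ltnS.
  - exact: iota_ltn_sorted.
have PE : P [set w | gamma_star j (fun i => X i w) <= x] =
    P [set w | spacing_sum c 0 (sorted_values (fun i => X i w)) <= 0].
  rewrite (exponential_family_positive r_gt0 famX); last exact: measurable_gamma_star.
  rewrite [RHS](exponential_family_positive r_gt0 famX); last first.
    by apply: measurable_le_set => //; exact: measurable_spacing_sum.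
  congr (P _); apply/seteqP; split => w /= [h X0]; split => //.
    by rewrite -gamma_star_le.
  by rewrite gamma_star_le.
have sumE : \sum_(1 <= i < n.+1) (\prod_(1 <= k < n.+1 | k != i)
      ((e_coef j n i - x) / (e_coef j n i - e_coef j n k)))
    * ind_lt x (e_coef j n i) = \sum_(b <- c | 0 < b) hypoexp_weight c b.
  have E : index_iota 1 n.+1 = iota 1 n by rewrite /index_iota subn1.
  rewrite E /c big_map [RHS]big_mkcond; apply: eq_big_seq => i.
  rewrite mem_iota add1n ltnS => ni.
  rewrite subr_gt0 /ind_lt; case: ifP => _; last by rewrite mulr0.
  rewrite mulr1 /hypoexp_weight big_map big_seq_cond [RHS]big_seq_cond.
  apply: eq_big => [k|k _].
    rewrite mem_iota add1n ltnS; case: (boolP (0 < k <= n)%N) => //= nk.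
    have [->|ki] := eqVneq k i; first by rewrite eqxx.
    by rewrite (inj_eq (addIr _)) e_distinct.
  by congr (_ / _); ring.
rewrite PE sumE.
move: n_ge1 X famX {X_indep X_cdf e_distinct mX PE sumE} @c sc.
case: n => // m _ X famX c sc.
have := spacing_sum_le0_prob r_gt0 famX _ sc.
by rewrite !mul1r; apply; rewrite size_map size_iota.
Qed.
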